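(* Let $\mathcal{R}=\mathcal{Q}\mathcal{K}$ be an RNN with output dimension $d$ and let $A\in\mathbb{R}^{d'\times d}$, $b\in\mathbb{R}^{d'}$, $d'\in\mathbb{N}$. Then there exists an RNN $\mathcal{R}'=\mathcal{Q}'\mathcal{K}$ (with the same hidden state operator $\mathcal{K}$) such that, for all $x\in\mathbb{R}^{\mathcal{M}_{\mathrm{in}}(\mathcal{R})}$ and all $t\in\mathbb{N}_0$, $$(\mathcal{R}'\mathcal{D}x)[t]=A\left((\mathcal{R}\mathcal{D}x)[t]\right)+b.$$
   Context: Notation: $\mathbb{N}=\{1,2,\dots\}$, $\mathbb{N}_0=\mathbb{N}\cup\{0\}$; $(\mathbb{R}^d)^{\mathbb{N}_0}$ is the space of sequences in $\mathbb{R}^d$ indexed by $\mathbb{N}_0$; $\rho(x)=\max(0,x)$, applied componentwise. RNN: An RNN with input dimension $p\in\mathbb{N}$, output dimension $q\in\mathbb{N}$ and hidden state size $m\in\mathbb{N}$ is given by weights $A_h\in\mathbb{R}^{m\times m}$, $A_x\in\mathbb{R}^{m\times p}$, $A_o\in\mathbb{R}^{q\times m}$, $b_h\in\mathbb{R}^m$, $b_o\in\mathbb{R}^{q}$. The hidden state operator $\mathcal{K}:(\mathbb{R}^p)^{\mathbb{N}_0}\to(\mathbb{R}^m)^{\mathbb{N}_0}$ maps an input sequence $(x[t])_{t\in\mathbb{N}_0}$ to $(\mathcal{K}x)[t]=h[t]$, where $h[-1]=0$ and $h[t]=\rho(A_hh[t-1]+A_xx[t]+b_h)$ for $t\in\mathbb{N}_0$.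 The output mapping is $\mathcal{Q}(h)=A_oh+b_o$. The associated RNN is $\mathcal{R}=\mathcal{Q}\mathcal{K}$, $(\mathcal{R}x)[t]=\mathcal{Q}((\mathcal{K}x)[t])$. Write $\mathcal{M}_{\mathrm{in}}(\mathcal{R})=p$ for the input dimension. The operator $\mathcal{D}:\mathbb{R}^p\to(\mathbb{R}^p)^{\mathbb{N}_0}$ is defined by $(\mathcal{D}x)[0]=x$ and $(\mathcal{D}x)[t]=0$ for $t\ge1$. *)

(* Defs.v *)
From mathcomp Require Import all_boot all_order all_algebra.
From mathcomp Require Import reals.

Set Implicit Arguments.
Unset Strict Implicit.
Unset Printing Implicit Defensive.

Import GRing.Theory Num.Theory.
Local Open Scope ring_scope.

(* Vectors of R^n are column vectors 'cV[R]_n; a sequence indexed by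
   {0, 1, 2, ...} is a function on nat. *)

Definition relu {R : realType} {n : nat} (v : 'cV[R]_n) : 'cV[R]_n :=
  map_mx (fun a : R => Num.max 0 a) v.

(* Input dimension p, hidden state size m, output dimension q, all positive. *)
Record rnn (R : realType) (p m q : nat) := RNN {
  in_gt0 : (0 < p)%N;
  hid_gt0 : (0 < m)%N;
  out_gt0 : (0 < q)%N;
  rnn_Ah : 'M[R]_m;
  rnn_Ax : 'M[R]_(m, p);
  rnn_Ao : 'M[R]_(q, m);
  rnn_bh : 'cV[R]_m;
  rnn_bo : 'cV[R]_q
}.

(* The inner match is h[t - 1], with h[-1] = 0. *)
Fixpoint hidden_op {R : realType} {p m q : nat} (N : rnn R p m q)
    (x : nat -> 'cV[R]_p) (t : nat) {struct t} : 'cV[R]_m :=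
  relu (rnn_Ah N *m (match t with
                     | 0%N => 0
                     | s.+1 => hidden_op N x s
                     end)
        + rnn_Ax N *m x t + rnn_bh N).

Definition output_map {R : realType} {p m q : nat} (N : rnn R p m q)
    (h : 'cV[R]_m) : 'cV[R]_q :=
  rnn_Ao N *m h + rnn_bo N.

Definition rnn_op {R : realType} {p m q : nat} (N : rnn R p m q)
    (x : nat -> 'cV[R]_p) (t : nat) : 'cV[R]_q :=
  output_map N (hidden_op N x t).

Definition delta_seq {R : realType} {p : nat} (x : 'cV[R]_p) (t : nat) :
    'cV[R]_p :=
  if t == 0%N then x else 0.

(* Main.v *)
Require Import Defs.
From mathcomp Require Import all_boot all_order all_algebra.
From mathcomp Require Import reals.

Local Open Scope ring_scope.

(** An affine map after the affine output map is again affine, so $A$ and $b$ can be absorbed into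
    the readout while the recurrence stays untouched. [hidden_op_eq_weights] guarantees that the
    hidden states are then unchanged. *)

(** [hidden_op] takes the whole record, readout included, so its independence of the readout needs
    an induction on time. *)
Lemma hidden_op_eq_weights (R : realType) (p m q q' : nat)
    (N : rnn R p m q) (N' : rnn R p m q') :
  rnn_Ah N' = rnn_Ah N -> rnn_Ax N' = rnn_Ax N -> rnn_bh N' = rnn_bh N ->
  forall (x : nat -> 'cV[R]_p) (t : nat), hidden_op N' x t = hidden_op N x t.
Proof.
move=> eqAh eqAx eqbh x; elim=> [|t IHt] /=; first by rewrite eqAh eqAx eqbh.
by rewrite IHt eqAh eqAx eqbh.
Qed.

Theorem mainTheorem6 (R : realType) (p m d d' : nat) (N : rnn R p m d)
    (A : 'M[R]_(d', d)) (b : 'cV[R]_d') (d'_gt0 : (0 < d')%N) :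
  exists N' : rnn R p m d',
    (forall (x : nat -> 'cV[R]_p) (t : nat),
      hidden_op N' x t = hidden_op N x t) /\
    forall (x : 'cV[R]_p) (t : nat),
      rnn_op N' (delta_seq x) t = A *m rnn_op N (delta_seq x) t + b.
Proof.
(* The new readout comes from expanding $A(A_o h + b_o) + b = (A A_o) h + (A b_o + b)$. *)
pose N' := RNN (in_gt0 N) (hid_gt0 N) d'_gt0 (rnn_Ah N) (rnn_Ax N)
  (A *m rnn_Ao N) (rnn_bh N) (A *m rnn_bo N + b).
have eq_hidden : forall x t, hidden_op N' x t = hidden_op N x t.
  exact: hidden_op_eq_weights.
exists N'; split=> // x t.
by rewrite /rnn_op eq_hidden /output_map /= mulmxDr mulmxA GRing.addrA.
Qed.
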